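(* Let $r>0$ be real. The exponential generating function (in $n$) of the polynomials $\omega_{n,r}(x)$ is $$\left(1-x(e^{t}-1)\right)^{-r}=\sum_{n=0}^{\infty}\omega_{n,r}(x)\frac{t^{n}}{n!},$$ as an identity of formal power series in $t$ (equivalently, for each fixed $x$, for all sufficiently small $|t|$). In particular, when $r=1$, $$\frac{1}{1-x(e^{t}-1)}=\sum_{n=0}^{\infty}\omega_{n}(x)\frac{t^{n}}{n!}.$$
   Context: $S(n,k)$ denotes the Stirling numbers of the second kind. For $r>0$ the geometric polynomials are $\omega_{n,r}(x)=\frac{1}{\Gamma(r)}\sum_{k=0}^{n}S(n,k)\Gamma(k+r)x^{k}$, and $\omega_n(x)=\omega_{n,1}(x)=\sum_{k=0}^{n}S(n,k)\,k!\,x^{k}$. *)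

(* Defs.v *)
From HB Require Import structures.
From mathcomp Require Import all_boot all_order all_algebra.
From mathcomp Require Import all_classical all_reals all_analysis.
Import Order.TTheory GRing.Theory Num.Theory.
Import numFieldNormedType.Exports.

Set Implicit Arguments.
Unset Strict Implicit.
Unset Printing Implicit Defensive.

Local Open Scope classical_set_scope.
Local Open Scope ring_scope.

Definition stirling2 (n k : nat) : nat :=
  #|[set P : {set {set 'I_n}} | finset.partition P [set: 'I_n] & #|P| == k]%SET|.

(* Euler's integral; the integral is finite for 0 < s, the only case of
   interest. *)
Definition Gamma (R : realType) (s : R) : R :=
  (\int[lebesgue_measure]_(u in `]0%R, +oo[) (u `^ (s - 1) * expR (- u)))%R.

Definition geom_polyr (R : realType) (r : R) (n : nat) : {poly R} :=
  (Gamma r)^-1 *: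
    \sum_(k < n.+1) ((stirling2 n k)%:R * Gamma (k%:R + r)) *: 'X^k.

Definition geom_poly (R : realType) (n : nat) : {poly R} :=
  \sum_(k < n.+1) ((stirling2 n k * k`!)%N%:R : R) *: 'X^k.

(* A formal power series \sum_n f_n t^n over A is the sequence of its
   coefficients.  The operations are named because the ring operations that
   the library puts on nat -> A are pointwise, so its product is not the
   Cauchy product. *)
Definition fps (A : Type) := nat -> A.

Section FormalPowerSeries.
Variables (K : fieldType) (A : algType K).
Implicit Types (f g v : fps A) (a : K).

Definition fps_one : fps A := fun n => (n == 0)%:R.

Definition fps_sub f g : fps A := fun n => f n - g n.

Definition fps_scale (c : A) f : fps A := fun n => c * f n.

Definition fps_mul f g : fps A := fun n => \sum_(i < n.+1) f i * g (n - i)%N.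

Definition fps_pow f (k : nat) : fps A := iter k (fps_mul f) fps_one.

(* \sum_n f_n t^n / n! *)
Definition fps_egf (f : nat -> A) : fps A := fun n => (n`!%:R : K)^-1 *: f n.

Definition fps_exp : fps A := fps_egf (fun=> 1).

(* a (a - 1) ... (a - k + 1) / k! *)
Definition gen_binomial a (k : nat) : K := (\prod_(i < k) (a - i%:R)) / k`!%:R.

(* f ^ a = \sum_k (a choose k) (f - 1)^k for f with constant coefficient 1;
   then (f - 1)^k has order at least k, so that only the terms with k <= n
   contribute to the coefficient of t^n.  Junk if f 0 != 1. *)
Definition fps_powr f a : fps A := fun n =>
  \sum_(k < n.+1) gen_binomial a k *: fps_pow (fps_sub f fps_one) k n.

End FormalPowerSeries.

Arguments fps_one {K A}.
Arguments fps_exp {K A}.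

(* 1 - x (e^t - 1) as a power series in t over R[x]; x is the polynomial
   indeterminate 'X. *)
Definition fps_base (R : realType) : fps {poly R} :=
  fps_sub fps_one (fps_scale 'X (fps_sub fps_exp fps_one)).
Arguments fps_base {R}.

(* Main.v *)
Require Import Defs.
From HB Require Import structures.
From mathcomp Require Import all_boot all_order all_algebra.
From mathcomp Require Import all_classical all_reals all_analysis.
From mathcomp Require Import measurable_realfun.
From mathcomp Require Import ring lra zify.
Import Order.TTheory GRing.Theory Num.Theory.
Import numFieldNormedType.Exports.

Set Implicit Arguments.
Unset Strict Implicit.
Unset Printing Implicit Defensive.

Local Open Scope classical_set_scope.
Local Open Scope ring_scope.

(** Write E for e^t - 1.  Everything rests on
      E^k = k! \sum_n S(n,k) t^n / n!,
    read either as an identity of formal power series or as a convergent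
    expansion for real t.  Expanding (1 - x E)^(-r) by the binomial series
    \sum_k r (r + 1) ... (r + k - 1) / k! (x E)^k, and then each power of E,
    gives \sum_n (\sum_k S(n,k) r (r + 1) ... (r + k - 1) x^k) t^n / n!, and
    Gamma (k + r) = Gamma r * r (r + 1) ... (r + k - 1) identifies the inner sum
    with the geometric polynomial.

    Stirling numbers.  Sorting the maps from an n-set to an m-set by the
    partition of their fibres gives m^n = \sum_j S(n,j) m (m - 1) ... (m - j + 1)
    ([expn_stirling2]).  Applying the k-th forward difference at 0 kills all
    falling factorials but the k-th, so k! S(n,k) is the k-th difference of
    m |-> m^n at 0 ([iter_fdiff_expn]).  Differences are what makes both readings
    of the formula for E^k short: formally, (m + 1)^n - m^n is the binomial
    convolution of m |-> m^n with E ([fps_exp_sub1_pow]); analytically,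
    the series of e^(m t) may be differenced termwise in m, and the k-th
    difference of m |-> e^(m t) is e^(m t) E^k ([cvg_iter_fdiff_series]).

    Formal part.  With the formula for E^k, the power with exponent -r is a finite
    sum in each degree and the identity is read off coefficientwise
    ([fps_powr_base]).  For r = 1, the product of 1 - x E with the sum of the
    (x E)^k telescopes ([fps_mul_base_geom_poly]).

    Gamma function.  Integration by parts on [1/(n+1), n+2] and monotone
    convergence give the functional equation for the extended-real integrals.
    Since the integral at s + 1 is finite and positive by comparison with
    explicit functions, the equation shows the same at s ([GammaS], [Gamma_gt0]).

    Analytic part.  Only small t matter, so the binomial series is needed only for
    small u, where a crude geometric bound on its coefficients suffices; its sum
    F satisfies (1 - u) F' = r F, so that F(u) (1 - u)^r is constant
    ([cvg_binomial_series]).  The exchange of the two summations is Tannery's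
    theorem ([tannery]), the dominating series being the same binomial series at
    |x| (e^|t| - 1). *)

(** * Stirling numbers as finite differences *)

Section SetPartitions.
Import mathcomp.boot.finset.

Lemma card_partition_le (T : finType) (P : {set {set T}}) (D : {set T}) :
  partition P D -> (#|P| <= #|D|)%N.
Proof.
move=> PD; rewrite (card_partition PD) -sum1_card; apply: leq_sum => B BP.
by rewrite card_gt0; have [_ _ /memPn] := and3P PD; apply.
Qed.

(** A map whose fibres are the blocks of P is the same thing as an injective
    choice of a value for each block. *)
Lemma card_preim_partition (T U : finType) (P : {set {set T}}) :
  partition P [set: T]%SET ->
  #|[set f : {ffun T -> U} | preim_partition f [set: T]%SET == P]%SET|
  = (#|U| ^_ #|P|)%N.
Proof.
move=> PT; have [/eqP cP tP P0] := and3P PT.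
have memP (x : T) : pblock P x \in P by rewrite pblock_mem// cP in_setT.
pose blk x : {B | B \in P} := exist _ (pblock P x) (memP x).
pose phi (g : {ffun {B | B \in P} -> U}) := [ffun x => g (blk x)].
have blkP (B : {B | B \in P}) : exists x, blk x = B.
  have /set0Pn[x xB] : val B != set0 by exact: (memPn P0 _ (valP B)).
  by exists x; apply/val_inj => /=; rewrite (def_pblock tP (valP B) xB).
have phi_inj : injective phi.
  move=> g h /ffunP gh; apply/ffunP => B; have [x <-] := blkP B.
  by have := gh x; rewrite !ffunE.
have <- : #|{: {B | B \in P}}| = #|P| by rewrite card_sig.
rewrite -card_inj_ffuns -(card_imset _ phi_inj); apply: eq_card => f.
rewrite !inE; apply/eqP/imsetP => [fP|[g]].
  have fE x y : (pblock P x == pblock P y) = (f x == f y).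
    rewrite eq_pblock ?cP ?in_setT// -fP.
    rewrite /preim_partition pblock_equivalence_partition ?in_setT//.
    by split=> // /eqP->.
  (* The value of f on any representative of the block. *)
  pose g := [ffun B : {B | B \in P} => f (sval (cid (blkP B)))].
  have gE x : g (blk x) = f x.
    rewrite ffunE; case: cid => y /= /(congr1 val) /= yx.
    by apply/eqP; rewrite -fE yx.
  exists g; last by apply/ffunP => x; rewrite ffunE gE.
  rewrite inE; apply/injectiveP => B C.
  have [x <-] := blkP B; have [y <-] := blkP C; rewrite !gE => /eqP.
  by rewrite -fE => /eqP xy; apply/val_inj.
rewrite inE => /injectiveP g_inj ->; rewrite -[RHS](preim_partition_pblock PT).
apply: eq_imset => x; apply/setP => y; rewrite !inE !ffunE /=.
by rewrite (inj_eq g_inj) -val_eqE.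
Qed.

Lemma stirling2_gt n k : (n < k)%N -> stirling2 n k = 0%N.
Proof.
move=> nk; apply/eqP; rewrite cards_eq0; apply/eqP/setP => P; rewrite !inE.
apply/negP => /andP[/card_partition_le]; rewrite cardsT card_ord => + /eqP Pk.
by rewrite Pk leqNgt nk.
Qed.

(** Both sides count the maps from an n-set to an m-set, the right-hand side
    according to the number of blocks of the partition into fibres. *)
Lemma expn_stirling2 m n :
  (m ^ n = \sum_(j < n.+1) stirling2 n j * m ^_ j)%N.
Proof.
transitivity #|{: {ffun 'I_n -> 'I_m}}|; first by rewrite card_ffun !card_ord.
rewrite -sum1_card (partition_big (fun f : {ffun 'I_n -> 'I_m} =>
  preim_partition f [set: 'I_n]%SET) (partition ^~ [set: 'I_n]%SET)) /=;
  last by move=> f _; exact: preim_partitionP.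
under eq_bigr => P PT.
  rewrite sum1dep_card (card_preim_partition _ PT) card_ord.
  over.
rewrite (partition_big (fun P : {set {set 'I_n}} => inord #|P| : 'I_n.+1) xpredT) //=.
apply: eq_bigr => j _; rewrite /stirling2 -sum1dep_card big_distrl /=.
have jP (P : {set {set 'I_n}}) : partition P [set: 'I_n]%SET ->
    (inord #|P| == j) = (#|P| == j).
  move=> /card_partition_le; rewrite cardsT card_ord => Pn.
  by rewrite -val_eqE /= inordK.
under eq_bigl => P do rewrite (andb_id2l (@jP P)).
by apply: eq_bigr => P /andP[_ /eqP ->]; rewrite mul1n.
Qed.

End SetPartitions.

Definition fdiff (V : zmodType) (g : nat -> V) (m : nat) : V := g m.+1 - g m.
Arguments fdiff {V}.

Section FiniteDifferences.
Variable K : nzRingType.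
Implicit Types (g : nat -> K) (k m n : nat).

Lemma iter_fdiff_ext k g h m : g =1 h -> iter k fdiff g m = iter k fdiff h m.
Proof. by move=> /funext ->. Qed.

Lemma iter_fdiff_sum (I : finType) k (c : I -> K) (g : I -> nat -> K) m :
  iter k fdiff (fun i => \sum_j c j * g j i) m =
  \sum_j c j * iter k fdiff (g j) m.
Proof.
elim: k m => [//|k IH] m; rewrite iterS /fdiff !IH -sumrB.
by apply: eq_bigr => j _; rewrite mulrBr.
Qed.

Lemma fdiff_ffact i m :
  fdiff (fun m => (m ^_ i)%:R) m = i%:R * (m ^_ i.-1)%:R :> K.
Proof.
rewrite /fdiff; case: i => [|i] /=; first by rewrite !ffactn0 subrr mul0r.
apply/eqP; rewrite subr_eq -natrM -natrD ffactSS ffactnSr; apply/eqP.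
congr (_%:R); have [mi|im] := ltnP m i; first by rewrite ffact_small//; lia.
by rewrite [(_ ^_ _ * _)%N]mulnC -mulnDl; congr (_ * _)%N; lia.
Qed.

(** Falling factorials behave under differences as monomials do under
    derivatives. *)
Lemma iter_fdiff_ffact k j m :
  iter k fdiff (fun m => (m ^_ j)%:R) m
  = (j ^_ k)%:R * (m ^_ (j - k))%:R :> K.
Proof.
elim: k m => [|k IH] m; first by rewrite subn0 ffactn0 mul1r.
rewrite iterS /fdiff !IH -mulrBr ffactnSr natrM -mulrA subnS.
by congr (_ * _); exact: fdiff_ffact.
Qed.

(** Differencing [expn_stirling2] k times at 0 leaves only the term j = k: for
    j < k the polynomial is killed, and for j > k its difference vanishes at 0. *)
Lemma iter_fdiff_expn n k :
  iter k fdiff (fun m => (m ^ n)%:R) 0 = (k`! * stirling2 n k)%:R :> K.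
Proof.
under iter_fdiff_ext => m.
  rewrite expn_stirling2 natr_sum; under eq_bigr do rewrite natrM; over.
rewrite iter_fdiff_sum.
under eq_bigr do rewrite iter_fdiff_ffact.
have [kn|nk] := ltnP k n.+1; last first.
  rewrite stirling2_gt// muln0 big1// => j _.
  by rewrite ffact_small ?mul0r ?mulr0//; have := ltn_ord j; lia.
rewrite (bigD1 (Ordinal kn))//= subnn ffactnn ffactn0 mulr1 big1 ?addr0.
  by rewrite -natrM mulnC.
move=> j; rewrite -val_eqE /= => jk; have [jk'|kj] := ltnP j k.
  by rewrite (ffact_small jk') mul0r mulr0.
by rewrite (@ffact_small 0) ?mulr0//; lia.
Qed.

End FiniteDifferences.

(** * The formal identity *)

Definition rising_fact (K : pzRingType) (r : K) (k : nat) : K :=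
  \prod_(i < k) (r + i%:R).

Lemma rising_factS (K : pzRingType) (r : K) k :
  rising_fact r k.+1 = rising_fact r k * (r + k%:R).
Proof. by rewrite /rising_fact big_ord_recr. Qed.

Lemma rising_fact1 (K : pzRingType) k : rising_fact (1 : K) k = k`!%:R.
Proof.
elim: k => [|k IH]; first by rewrite /rising_fact big_ord0.
by rewrite rising_factS IH nat1r -natrM factS mulnC.
Qed.

Lemma gen_binomialN (K : fieldType) (r : K) k :
  gen_binomial (- r) k = (-1) ^+ k * rising_fact r k / k`!%:R.
Proof.
rewrite /gen_binomial /rising_fact; congr (_ / _).
elim: k => [|k IH]; first by rewrite !big_ord0 expr0 mulr1.
by rewrite !big_ord_recr /= IH exprS; ring.
Qed.

Lemma fps_powS (K : fieldType) (A : algType K) (f : fps A) k n :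
  fps_pow f k.+1 n = \sum_(i < n.+1) f i * fps_pow f k (n - i)%N.
Proof. by []. Qed.

(** The coefficient of t^n / n! in (e^t - 1)^k.  The induction step reads
    (m + 1)^n - m^n = \sum_(0 < i <= n) C(n,i) m^(n - i), in which
    C(n,i) / n! = 1 / (i! (n - i)!) turns the sum into a Cauchy product. *)
Lemma fps_exp_sub1_pow (K : numFieldType) (A : algType K) k n :
  fps_pow (fps_sub fps_exp fps_one) k n =
  (n`!%:R : K)^-1 *: (iter k fdiff (fun m => (m ^ n)%:R) 0 : A).
Proof.
elim: k n => [|k IH] n.
  by rewrite /= /fps_one; case: n => [|n]; rewrite ?invr1 ?scale1r// exp0n// scaler0.
rewrite fps_powS iterSr.
have fact0 j : (j`!%:R : K) != 0 by rewrite pnatr_eq0 -lt0n fact_gt0.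
under [in RHS]iter_fdiff_ext => m.
  have -> : fdiff (fun m => (m ^ n)%:R) m =
      \sum_(i < n.+1) ('C(n, i) * (i != 0 :> nat))%:R * (m ^ (n - i)%N)%:R :> A.
    rewrite /fdiff -addn1 expnDn big_ord_recl /= bin0 mul1n subn0 expn0 muln1.
    rewrite natrD addrAC subrr add0r natr_sum big_ord_recl /= muln0 mul0r add0r.
    by apply: eq_bigr => i _; rewrite exp1n !muln1 natrM.
  over.
rewrite iter_fdiff_sum scaler_sumr; apply: eq_bigr => i _; rewrite IH.
rewrite /fps_sub /fps_exp /fps_egf /fps_one.
have [->|i0] := eqVneq (i : nat) 0%N.
  by rewrite invr1 scale1r subrr mul0r muln0 mul0r scaler0.
rewrite subr0 muln1; set D := iter _ _ _ _.
have -> : 'C(n, i)%:R * D = ('C(n, i)%:R : K) *: D.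
  by rewrite scaler_nat mulr_natl.
rewrite scalerA -scalerAl mul1r scalerA.
congr (_ *: _); rewrite -(bin_fact (_ : i <= n)%N) -1?ltnS// !natrM.
have C0 : ('C(n, i)%:R : K) != 0 by rewrite pnatr_eq0 -lt0n bin_gt0 -ltnS.
by field; rewrite !fact0.
Qed.

Lemma fps_pow_scale (K : fieldType) (A : comAlgType K) (c : A) (f : fps A) k n :
  fps_pow (fps_scale c f) k n = c ^+ k * fps_pow f k n.
Proof.
elim: k n => [|k IH] n; first by rewrite mul1r.
rewrite !fps_powS mulr_sumr; apply: eq_bigr => i _.
by rewrite IH exprS mulrACA.
Qed.

Section Formal.
Variable R : realType.

Lemma fps_exp_sub1_pow_stirling2 k n :
  fps_pow (fps_sub fps_exp fps_one : fps {poly R}) k n =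
  ((k`! * stirling2 n k)%:R / n`!%:R)%:P.
Proof.
by rewrite fps_exp_sub1_pow iter_fdiff_expn -polyC_natr -mul_polyC -polyCM mulrC.
Qed.

Lemma fps_base_sub1 :
  fps_sub fps_base fps_one = fps_scale (- 'X) (fps_sub fps_exp fps_one) :> fps {poly R}.
Proof.
by apply/funext => n; rewrite /fps_base /fps_sub /fps_scale /fps_one mulNr addrAC subrr add0r.
Qed.

(** The geometric polynomial with Gamma (k + r) / Gamma r replaced by its value
    r (r + 1) ... (r + k - 1). *)
Definition geom_poly_rising (r : R) n : {poly R} :=
  \sum_(k < n.+1) ((stirling2 n k)%:R * rising_fact r k) *: 'X^k.

(** The signs of the generalized binomial coefficient of -r cancel those of the
    powers of 1 - x (e^t - 1) - 1 = - x (e^t - 1). *)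
Lemma fps_powr_base (r : R) n :
  fps_powr fps_base (- r) n = fps_egf (geom_poly_rising r) n.
Proof.
rewrite /fps_powr /fps_egf scaler_sumr fps_base_sub1; apply: eq_bigr => k _.
rewrite fps_pow_scale fps_exp_sub1_pow_stirling2 gen_binomialN.
have -> : (- 'X) ^+ k = (-1) ^+ k *: 'X^k :> {poly R}.
  by rewrite -mul_polyC rmorphXn rmorphN1 exprNn.
rewrite [_ * _%:P]mulrC mul_polyC !scalerA; congr (_ *: _).
have fact0 j : (j`!%:R : R) != 0 by rewrite pnatr_eq0 -lt0n fact_gt0.
have s : (-1) ^+ k * (-1) ^+ k = 1 :> R by rewrite -expr2 sqrr_sign.
rewrite natrM.
transitivity ((-1) ^+ k * (-1) ^+ k * rising_fact r k * (stirling2 n k)%:R / n`!%:R).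
  by field; rewrite !fact0.
by rewrite s; ring.
Qed.

Lemma geom_poly1 : geom_poly R = geom_poly_rising 1.
Proof. by apply/funext => n; apply: eq_bigr => k _; rewrite rising_fact1 natrM. Qed.

(** The bound N is free because (e^t - 1)^k has no term of degree n < k; a bound
    common to all degrees is what the Cauchy product needs. *)
Lemma fps_egf_geom_poly n N : (n < N)%N ->
  fps_egf (@geom_poly R) n =
  \sum_(k < N) 'X^k * fps_pow (fps_sub fps_exp fps_one) k n.
Proof.
move=> nN; rewrite /fps_egf scaler_sumr.
under eq_bigr => k _.
  rewrite scalerA mulrC mulnC -mul_polyC -fps_exp_sub1_pow_stirling2 mulrC.
  over.
rewrite (big_ord_widen _ (fun k => 'X^k * fps_pow (fps_sub fps_exp fps_one) k n) nN).
rewrite big_mkcond; apply: eq_bigr => k _; case: ifPn => //.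
rewrite -leqNgt => nk; rewrite fps_exp_sub1_pow_stirling2 stirling2_gt//.
by rewrite muln0 mul0r mulr0.
Qed.

(** (1 - x E) \sum_(k <= n) (x E)^k = 1 - (x E)^(n + 1), and the last power has no
    term of degree n. *)
Lemma fps_mul_base_geom_poly n :
  fps_mul fps_base (fps_egf (@geom_poly R)) n = fps_one n.
Proof.
set e : fps {poly R} := fps_sub fps_exp fps_one.
have -> : fps_mul fps_base (fps_egf (@geom_poly R)) n =
    fps_egf (@geom_poly R) n - \sum_(k < n.+1) 'X ^+ k.+1 * fps_pow e k.+1 n.
  have -> : fps_egf (@geom_poly R) n =
      \sum_(i < n.+1) fps_one i * fps_egf (@geom_poly R) (n - i)%N.
    rewrite big_ord_recl mul1r subn0 big1 ?addr0// => i _.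
    by rewrite /fps_one /= mul0r.
  have -> : \sum_(k < n.+1) 'X ^+ k.+1 * fps_pow e k.+1 n =
      \sum_(i < n.+1) 'X * e i * fps_egf (@geom_poly R) (n - i)%N.
    under [RHS]eq_bigr => i _.
      rewrite (@fps_egf_geom_poly _ n.+1) ?ltnS ?leq_subr// mulr_sumr; over.
    rewrite exchange_big; apply: eq_bigr => k _.
    rewrite fps_powS mulr_sumr; apply: eq_bigr => i _.
    by rewrite exprS mulrACA.
  by rewrite -sumrB; apply: eq_bigr => i _; rewrite -mulrBl.
rewrite (fps_egf_geom_poly (ltnSn n)) -sumrB.
under eq_bigr do rewrite -opprB.
rewrite sumrN -(big_mkord xpredT (fun k => 'X ^+ k.+1 * fps_pow e k.+1 n - 'X^k * fps_pow e k n)).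
rewrite telescope_sumr// fps_exp_sub1_pow_stirling2 stirling2_gt//.
by rewrite muln0 mul0r mulr0 sub0r opprK mul1r.
Qed.

End Formal.

(** * The functional equation of the Gamma function *)

Section GammaFunction.
Variable R : realType.
Implicit Types (s u a b c p : R).
Notation mu := (@lebesgue_measure R).

(** Raise c u / p <= e^(c u / p) to the power p. *)
Lemma powR_le_expR p c u : 0 < p -> 0 < c -> 0 <= u ->
  u `^ p <= (p / c) `^ p * expR (c * u).
Proof.
move=> p0 c0 u0.
have -> : expR (c * u) = expR (c * u / p) `^ p.
  by rewrite /powR gt_eqF ?expR_gt0// expRK [p * _]mulrC divfK// gt_eqF.
have pc0 : 0 < p / c by rewrite divr_gt0.
rewrite -powRM ?expR_ge0 ?(ltW pc0)//.
have uE : u = p / c * (c * u / p) by field; rewrite !gt_eqF.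
have le : u <= p / c * expR (c * u / p).
  rewrite [leLHS]uE ler_pM2l//; apply: le_trans (expR_ge1Dx _).
  by rewrite lerDr.
apply: (ge0_ler_powR (ltW p0) _ _ le); by rewrite nnegrE ?(le_trans u0 le).
Qed.

Let gamma_fun s u := u `^ (s - 1) * expR (- u).

Let gamma_fun_ge0 s u : 0 <= gamma_fun s u.
Proof. by rewrite mulr_ge0 ?powR_ge0 ?expR_ge0. Qed.

Let measurable_gamma_fun s (D : set R) :
  measurable_fun D (fun u => (gamma_fun s u)%:E).
Proof.
apply/measurable_EFinP; apply: measurable_funTS; apply: measurable_funM.
  exact: measurable_powR.
by apply: measurableT_comp => //; exact: measurableT_comp.
Qed.

(** Euler's integral as an extended real, so that it may be handled before it is
    known to be finite. *)
Let eGamma s := (\int[mu]_(u in `]0%R, +oo[) (gamma_fun s u)%:E)%E.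

Let eGamma_ge0 s : (0 <= eGamma s)%E.
Proof. by apply: integral_ge0 => u _; rewrite lee_fin. Qed.

(** Staying away from 0 keeps the integrand continuous also for s < 1, where it is
    singular at 0. *)
Let integral_gamma_fun_parts s a b : 0 < s -> 0 < a -> a < b ->
  (\int[mu]_(u in `[a, b]) (gamma_fun (s + 1) u)%:E =
   (a `^ s * expR (- a) - b `^ s * expR (- b))%:E +
   s%:E * \int[mu]_(u in `[a, b]) (gamma_fun s u)%:E)%E.
Proof.
move=> s0 a0 ab.
have pos u : u \in `[a, b] -> u \in `]0, +oo[.
  by rewrite !in_itv /= andbT => /andP[au _]; exact: lt_le_trans au.
have poso u : u \in `]a, b[ -> u \in `]0, +oo[.
  by move=> uab; apply: pos; exact: subset_itv_oo_cc.
have der p u : u \in `[a, b] -> derivable (@powR R ^~ p) u 1.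
  by move=> /pos uab; exact: derivable_powR.
have cpow p : {within `[a, b], continuous (@powR R ^~ p)}.
  by apply: derivable_within_continuous => u; exact: der.
have dexp u : is_derive u 1 (fun u => - expR (- u)) (expR (- u)).
  by apply: is_derive_eq; rewrite mulrN1 opprK.
have cexp : {within `[a, b], continuous (fun u : R => expR (- u))}.
  by apply: derivable_within_continuous => u _; exact: ex_derive.
have LR f : {within `[a, b], continuous f} ->
    (forall u, u \in `]a, b[ -> derivable f u 1) -> derivable_oo_LRcontinuous f a b.
  by move=> /(continuous_within_itvP _ ab)[_ fa fb] df; split.
rewrite /gamma_fun addrK (@integration_by_parts R (@powR R ^~ s)
  (fun u => - expR (- u)) (fun u => s * u `^ (s - 1)) (fun u => expR (- u)))//.
- under eq_integral => u _.
    rewrite (_ : _%:E = - (s%:E * (gamma_fun s u)%:E))%E; last first.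
      by rewrite -EFinM -EFinN mulrN mulrA.
    over.
  rewrite integral_ge0N; last by move=> u _; rewrite mule_ge0// lee_fin// ltW.
  rewrite ge0_integralZl_EFin ?oppeK ?(ltW s0)//; last 2 first.
  + by move=> u _; rewrite lee_fin.
  + exact: measurable_gamma_fun.
  by congr (_%:E + _)%E; rewrite !mulrN opprK addrC.
- by apply: derivable_within_continuous => u uab; apply: derivableM => //; exact: der.
- by apply: LR => // u uab; apply: der; exact: subset_itv_oo_cc.
- by move=> u /poso uab; exact: powR_derive1.
- by apply: LR => //; apply: derivable_within_continuous => u _; exact: ex_derive.
- by move=> u _; rewrite derive1E derive_val.
Qed.

Let itv_0y_bigcup : `]0%R, +oo[%classic =
  \bigcup_n [set` `[harmonic n, n.+2%:R]] :> set R.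
Proof.
apply/seteqP; split=> u /=; last first.
  by move=> [n _] /=; rewrite !in_itv /= andbT => /andP[+ _]; exact: lt_le_trans.
rewrite in_itv /= andbT => u0; pose n := Num.trunc (u + u^-1).
have un : u + u^-1 < n.+1%:R by exact: truncnS_gt.
exists n => //=; rewrite in_itv /=; apply/andP; split.
  rewrite /harmonic /= -[leRHS]invrK lef_pV2 ?posrE ?invr_gt0//.
  by apply: ltW; apply: le_lt_trans un; rewrite lerDr ltW.
apply: ltW; apply: lt_le_trans (_ : n.+1%:R <= _); last by rewrite ler_nat.
by apply: le_lt_trans un; rewrite lerDl invr_ge0 ltW.
Qed.

Let cvg_integral_gamma_fun s :
  (\int[mu]_(u in `[harmonic n, n.+2%:R]) (gamma_fun s u)%:E)%E @[n --> \oo]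
    --> eGamma s.
Proof.
rewrite /eGamma itv_0y_bigcup; apply: ge0_nondecreasing_set_cvg_integral => //.
- move=> m n mn; apply/subsetPset => u /=; rewrite !in_itv /= => /andP[lu um].
  apply/andP; split.
    by rewrite (le_trans _ lu)// /harmonic /= lef_pV2 ?posrE// ler_nat ltnS.
  by apply: (le_trans um); rewrite ler_nat !ltnS.
- by move=> n; exact: measurable_gamma_fun.
- by move=> n u _; rewrite lee_fin.
Qed.

(** At the lower end u^s tends to 0; at the upper end u^s e^(-u) is at most C / u,
    from the bound on u^(s + 1) e^(-u). *)
Let cvg_boundary s : 0 < s ->
  ((harmonic n `^ s * expR (- harmonic n) -
    n.+2%:R `^ s * expR (- n.+2%:R))%:E : \bar R) @[n --> \oo] --> 0%E.
Proof.
move=> s0; apply/cvg_EFin; first exact: nearW.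
rewrite -[0]subr0; apply: cvgB.
  apply: (@squeeze_cvgr _ _ _ _ (fun=> 0) (fun n => harmonic n `^ s)).
  - apply: nearW => n; rewrite mulr_ge0 ?powR_ge0 ?expR_ge0//=.
    by rewrite ler_piMr ?powR_ge0// -expR0 ler_expR oppr_le0 harmonic_ge0.
  - exact: cvg_cst.
  - apply: ((cvg_at_rightP _ _ _).1 (powR_cvg0 s0)).
    by split; [exact: harmonic_gt0|exact: cvg_harmonic].
(* The constant that [powR_le_expR] gives for the exponent s + 1 and c = 1. *)
pose C := ((s + 1) / 1) `^ (s + 1).
apply: (@squeeze_cvgr _ _ _ _ (fun=> 0) (fun n => C * harmonic n)).
- apply: nearW => n; rewrite mulr_ge0 ?powR_ge0 ?expR_ge0//=.
  have := @powR_le_expR (s + 1) 1 n.+2%:R.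
  rewrite addr_gt0// ltr01 ler0n mul1r => /(_ erefl erefl erefl).
  rewrite -mulr_powRB1 ?addrK ?addr_gt0// -/C => le.
  rewrite expRN ler_pdivrMr ?expR_gt0// mulrAC.
  rewrite ler_pdivlMr// (le_trans _ le)// mulrC ler_wpM2r ?powR_ge0//.
  by rewrite ler_nat.
- exact: cvg_cst.
- by rewrite -(mulr0 C); apply: cvgMl_tmp; exact: cvg_harmonic.
Qed.

(** Holds without knowing that either integral is finite. *)
Let eGammaS s : 0 < s -> eGamma (s + 1) = (s%:E * eGamma s)%E.
Proof.
move=> s0; rewrite -(cvg_lim _ (@cvg_integral_gamma_fun (s + 1)))//.
apply: cvg_lim => //.
under eq_fun => n.
  rewrite integral_gamma_fun_parts ?harmonic_gt0//; last first.
    apply: le_lt_trans (_ : 1 < _); last by rewrite ltr1n.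
    by rewrite /harmonic /= invf_le1// ler1n.
  over.
rewrite -[(s%:E * _)%E]add0e; apply: cvgeD => //; first exact: cvg_boundary.
by apply: cvgeZl => //; exact: cvg_integral_gamma_fun.
Qed.

(** u^s e^(-u) is at most a multiple of e^(-u/2), the density of the exponential
    law of rate 1/2 up to a factor. The exponent s is positive, so there is no
    singularity at 0. *)
Let eGammaS_lty s : 0 < s -> (eGamma (s + 1) < +oo)%E.
Proof.
move=> s0; pose C := (s / 2^-1) `^ s * 2.
have C0 : 0 <= C by rewrite mulr_ge0// powR_ge0.
have half0 : 0 < 2^-1 :> R by rewrite invr_gt0.
have mpdf (D : set R) :
    measurable_fun D (fun u => (exponential_pdf 2^-1 u)%:E : \bar R).
  by apply/measurable_EFinP; apply: measurable_funTS; exact: measurable_exponential_pdf.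
have pdf0 u : (0 <= (exponential_pdf (2^-1) u)%:E :> \bar R)%E.
  by rewrite lee_fin exponential_pdf_ge0// ltW.
apply: (@le_lt_trans _ _ (C%:E * \int[mu]_u (exponential_pdf 2^-1 u)%:E)%E);
  last by rewrite integral_exponential_pdf// mule1 ltry.
apply: (@le_trans _ _ (\int[mu]_(u in `]0%R, +oo[)
    (C%:E * (exponential_pdf 2^-1 u)%:E))%E).
  apply: ge0_le_integral => //.
  - by move=> u _; rewrite lee_fin.
  - exact: measurable_gamma_fun.
  - exact: (measurable_funeM _ (mpdf _)).
  move=> u /=; rewrite in_itv /= andbT => u0.
  rewrite -EFinM lee_fin exponential_pdfE ?(ltW u0)// /gamma_fun addrK.
  rewrite mulrA /C -(mulrA _ 2) divff// mulr1.
  apply: le_trans (_ : (s / 2^-1) `^ s * expR (2^-1 * u) * expR (- u) <= _).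
    by rewrite ler_wpM2r ?expR_ge0//; apply: powR_le_expR => //; exact: ltW.
  rewrite -mulrA -expRD ler_wpM2l ?powR_ge0// ler_expR.
  by lra.
rewrite ge0_integralZl_EFin//; last exact: mpdf.
rewrite lee_wpmul2l ?lee_fin//.
by apply: ge0_subset_integral => //; exact: mpdf.
Qed.

(** The functional equation carries finiteness from s + 1 down to s, which covers
    the singular range 0 < s < 1. *)
Let eGamma_fin s : 0 < s -> eGamma s \is a fin_num.
Proof.
move=> s0; rewrite ge0_fin_numE//; have := eGammaS_lty s0; rewrite eGammaS//.
by case: (eGamma s) => [x||] //; rewrite ?ltry ?ltNyr ?gt0_muley ?lte_fin.
Qed.

(** On [1, 2] the integrand u^s e^(-u) is at least e^(-2). *)
Let eGammaS_gt0 s : 0 < s -> (0 < eGamma (s + 1))%E.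
Proof.
move=> s0; apply: (@lt_le_trans _ _ (\int[mu]_(u in `[1%R, 2%R]) (expR (- 2))%:E)%E).
  rewrite integral_cst//= lebesgue_measure_itv /= lte_fin ltr1n -EFinB -EFinM.
  by rewrite lte_fin mulr_gt0 ?expR_gt0// subr_gt0 ltr1n.
apply: (@le_trans _ _ (\int[mu]_(u in `[1%R, 2%R]) (gamma_fun (s + 1) u)%:E)%E).
  apply: ge0_le_integral => //.
  - exact: measurable_gamma_fun.
  move=> u /=; rewrite in_itv /= => /andP[u1 u2]; rewrite lee_fin /gamma_fun addrK.
  apply: le_trans (_ : expR (- u) <= _); first by rewrite ler_expR lerN2.
  by rewrite ler_peMl ?expR_ge0// -(powRr0 u) ler_powR// ltW.
apply: ge0_subset_integral => //.
- exact: measurable_gamma_fun.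
- by move=> u _; rewrite lee_fin.
- by move=> u /=; rewrite !in_itv /= andbT => /andP[u1 _]; rewrite (lt_le_trans _ u1).
Qed.

Lemma GammaS s : 0 < s -> Gamma (s + 1) = s * Gamma s.
Proof.
move=> s0; rewrite /Gamma /Rintegral -/(gamma_fun (s + 1)) -/(gamma_fun s).
by rewrite -/(eGamma (s + 1)) -/(eGamma s) eGammaS// fineM// eGamma_fin.
Qed.

Lemma Gamma_gt0 s : 0 < s -> 0 < Gamma s.
Proof.
move=> s0; rewrite -(pmulr_rgt0 _ s0) -GammaS//; apply: fine_gt0.
by rewrite eGammaS_gt0// eGammaS_lty.
Qed.

Lemma Gamma_rising_fact s k : 0 < s -> Gamma (k%:R + s) = Gamma s * rising_fact s k.
Proof.
move=> s0; elim: k => [|k IH].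
  by rewrite add0r /rising_fact big_ord0 mulr1.
rewrite -natr1 addrAC GammaS ?IH ?rising_factS; first by ring.
by rewrite ltr_wpDl.
Qed.

End GammaFunction.

(** * Convergence for small t *)

Section Tannery.
Variable R : realType.
Implicit Types (c : nat -> nat -> R) (b B : nat -> R).

Lemma cvg_finite_sum c b K :
  (forall k, c k N @[N --> \oo] --> b k) ->
  (\sum_(0 <= k < K) c k N) @[N --> \oo] --> \sum_(0 <= k < K) b k.
Proof.
move=> cb; elim: K => [|K IH].
  by rewrite big_nil; under eq_cvg do rewrite big_nil; exact: cvg_cst.
rewrite big_nat_recr//=; under eq_cvg do rewrite big_nat_recr//=.
exact: cvgD.
Qed.

(** Dominated convergence for sums with a growing number of terms: beyond a fixed
    K the terms are controlled by the tail of B, and below K there are finitely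
    many limits. *)
Lemma tannery c b B (L : R) :
  (forall k N, `|c k N| <= B k) -> cvgn (series B) ->
  (forall k, c k N @[N --> \oo] --> b k) -> series b @ \oo --> L ->
  (\sum_(0 <= k < N) c k N) @[N --> \oo] --> L.
Proof.
move=> cB cvgB cb bL.
have B0 k : 0 <= B k by exact: le_trans (cB k 0).
have ndB : nondecreasing_seq (series B) by exact: nondecreasing_series.
apply/cvgrPdist_lt => e e0; have e3 : 0 < e / 3 by rewrite divr_gt0.
have /cvgrPdist_lt/(_ _ e3) nbK := bL.
have /cvgrPdist_lt/(_ _ e3) nBK := cvgB.
near \oo => K.
have bK : `|L - series b K| < e / 3 by near: K.
have BK : `|limn (series B) - series B K| < e / 3 by near: K.
have /cvgrPdist_lt/(_ _ e3) ncK := cvg_finite_sum (K := K) cb.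
near=> N.
have KN : (K <= N)%N by near: N; exact: nbhs_infty_ge.
have cK : `|series b K - \sum_(0 <= k < K) c k N| < e / 3 by near: N.
have tail : `|\sum_(K <= k < N) c k N| < e / 3.
  apply: le_lt_trans BK; apply: (le_trans (ler_norm_sum _ _ _)).
  apply: (@le_trans _ _ (\sum_(K <= k < N) B k)); first exact: ler_sum.
  rewrite -sub_series_geq// (le_trans _ (ler_norm _))// lerD2r.
  exact: nondecreasing_cvgn_le.
rewrite (big_cat_nat (n := K))//=.
set x := \sum_(0 <= i < K) _ in cK *; set y := \sum_(K <= i < N) _ in tail *.
have -> : L - (x + y) = (L - series b K) + (series b K - x) - y by ring.
apply: (le_lt_trans (ler_normB _ _)); apply: le_lt_trans (lerD (ler_normD _ _) (lexx _)) _.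
by lra.
Unshelve. all: by end_near. Qed.

End Tannery.

Section BinomialSeries.
Variable R : realType.
Implicit Types (r u x p : R) (c : nat -> R).

Lemma cvg_pseries_geometric_bound c M p u :
  (forall k, `|c k| <= M * p ^+ k) -> `|p * u| < 1 -> cvgn (pseries c u).
Proof.
move=> cM pu; apply: normed_cvg.
apply: (@series_le_cvg _ _ (geometric M `|p * u|)) => [k|k|k|].
- exact: normr_ge0.
- rewrite /geometric /= mulr_ge0 ?exprn_ge0//.
  by have := cM 0%N; rewrite expr0 mulr1; exact: le_trans.
- have M0 : 0 <= M by have := cM 0%N; rewrite expr0 mulr1; exact: le_trans.
  rewrite /geometric /= normrM normrX normrM exprMn mulrA.
  apply: ler_wpM2r; first exact: exprn_ge0.
  apply: (le_trans (cM k)); apply: ler_wpM2l => //.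
  by rewrite -normrX ler_norm.
- by apply: is_cvg_geometric_series; rewrite normr_id.
Qed.

(** Absorbs the factor k + 1 of the derived series into the ratio, as
    k + 1 <= 2^k. *)
Lemma pseries_diffs_geometric_bound c M p :
  0 <= p -> (forall k, `|c k| <= M * p ^+ k) ->
  forall k, `|pseries_diffs c k| <= (M * p) * (2 * p) ^+ k.
Proof.
move=> p0 cM k; rewrite /pseries_diffs normrM normr_nat.
have M0 : 0 <= M by have := cM 0%N; rewrite expr0 mulr1; exact: le_trans.
apply: (@le_trans _ _ (2 ^+ k * (M * p ^+ k.+1))).
  by apply: ler_pM => //; rewrite -natrX ler_nat ltn_expl.
by rewrite exprMn exprS; lra.
Qed.

(** The coefficient of u^k in (1 - u)^(-r). *)
Definition binomial_coef r k : R := rising_fact r k / k`!%:R.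

Lemma rising_fact_ge0 r k : 0 < r -> 0 <= rising_fact r k.
Proof. by move=> r0; apply: prodr_ge0 => i _; rewrite addr_ge0// ltW. Qed.

Lemma binomial_coefS r k :
  k.+1%:R * binomial_coef r k.+1 = (r + k%:R) * binomial_coef r k.
Proof.
rewrite /binomial_coef rising_factS factS natrM.
have f0 : (k`!%:R : R) != 0 by rewrite pnatr_eq0 -lt0n fact_gt0.
by field; rewrite f0 /= addrC natr1.
Qed.

Lemma binomial_coef_bound r k : 0 < r -> `|binomial_coef r k| <= 1 * (r + 1) ^+ k.
Proof.
move=> r0; rewrite mul1r ger0_norm ?divr_ge0 ?rising_fact_ge0//.
elim: k => [|k IH]; first by rewrite /binomial_coef /rising_fact big_ord0 divr1.
have k0 : 0 < k.+1%:R :> R by [].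
rewrite -(ler_pM2l k0) binomial_coefS exprS.
apply: (@le_trans _ _ ((r + k%:R) * (r + 1) ^+ k)).
  by rewrite ler_wpM2l// addr_ge0// ltW.
rewrite mulrA ler_wpM2r ?exprn_ge0 ?addr_ge0 ?(ltW r0)//.
rewrite -natr1; have : 0 <= k%:R * r by rewrite mulr_ge0// ltW.
by lra.
Qed.

Lemma is_derive_eq_const (f : R -> R) (K u : R) :
  (forall v : R, `|v| < K -> is_derive v 1 f 0) -> `|u| < K -> f u = f 0.
Proof.
move=> df uK.
have cst a b : a <= b -> `|a| < K -> `|b| < K -> f b = f a.
  rewrite !ltr_norml => ab /andP[Ka _] /andP[_ bK].
  have d v : v \in `[a, b] -> is_derive v 1 f 0.
    rewrite in_itv /= => /andP[av vb]; apply: df; rewrite ltr_norml.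
    by rewrite (lt_le_trans Ka av) (le_lt_trans vb bK).
  have cf : {within `[a, b], continuous f}.
    by apply: derivable_within_continuous => v /d dv; exact: ex_derive.
  have [v _] := MVT_segment ab (fun v vab => d v (subset_itv_oo_cc vab)) cf.
  by rewrite mul0r => /eqP; rewrite subr_eq0 => /eqP.
have K0 : `|0 : R| < K by rewrite normr0 (le_lt_trans _ uK).
by have [u0|u0] := leP 0 u; [exact: cst|rewrite (cst u 0)// ltW].
Qed.

(** The sum F of the series satisfies (1 - u) F' = r F by the recurrence for
    its coefficients, so F(u) (1 - u)^r has zero derivative and equals F(0) = 1.
    The radius 1 / (8 (r + 1)) leaves room for two term-by-term derivations, each
    of which doubles the ratio of the bound (r + 1)^k on the coefficients. *)
Lemma cvg_binomial_series r u : 0 < r -> `|u| < (8 * (r + 1))^-1 ->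
  series (fun k => binomial_coef r k * u ^+ k) @ \oo --> (1 - u) `^ (- r).
Proof.
move=> r0; set K := (8 * (r + 1))^-1 => uK.
set c := binomial_coef r.
have r1 : 0 < r + 1 by rewrite addr_gt0.
have K0 : 0 < K by rewrite invr_gt0 mulr_gt0.
have K1 : K < 1 by rewrite invf_lt1 ?mulr_gt0//; lra.
have rK : (r + 1) * K = 8^-1 by rewrite /K; field; rewrite gt_eqF.
have c0 k : `|c k| <= 1 * (r + 1) ^+ k by exact: binomial_coef_bound.
have c1 := pseries_diffs_geometric_bound (ltW r1) c0.
have c2 := pseries_diffs_geometric_bound (mulr_ge0 (ler0n _ 2) (ltW r1)) c1.
have cv0 : cvgn (pseries c K).
  by apply: cvg_pseries_geometric_bound c0 _; rewrite rK ger0_norm//; lra.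
have cv1 : cvgn (pseries (pseries_diffs c) K).
  apply: cvg_pseries_geometric_bound c1 _; rewrite -mulrA rK ger0_norm; lra.
have cv2 : cvgn (pseries (pseries_diffs (pseries_diffs c)) K).
  apply: cvg_pseries_geometric_bound c2 _; rewrite -!mulrA rK ger0_norm; lra.
pose F (v : R) : R := limn (pseries c v).
pose G (v : R) : R := limn (pseries (pseries_diffs c) v).
have dF (v : R) : `|v| < K -> is_derive v 1 F (G v).
  by move=> vK; apply: pseries_snd_diffs cv2 _ => //; rewrite (gtr0_norm K0).
have cvF v : `|v| < K -> pseries c v @ \oo --> F v.
  by move=> vK; apply: is_cvg_pseries_inside cv0 _; rewrite (gtr0_norm K0).
have cvG v : `|v| < K -> pseries (pseries_diffs c) v @ \oo --> G v.
  by move=> vK; apply: is_cvg_pseries_inside cv1 _; rewrite (gtr0_norm K0).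
have ode v : `|v| < K -> (1 - v) * G v = r * F v.
  move=> vK; have vG := pseries_diffs_equiv (cvgP _ (cvG v vK)).
  have lhs : pseries (pseries_diffs c) v n -
      v * series (fun i => i%:R * c i * v ^+ i.-1) n @[n --> \oo] --> G v - v * G v.
    by apply: cvgB; [exact: cvG|apply: cvgMl_tmp; exact: vG].
  have rhs : r * pseries c v n @[n --> \oo] --> r * F v by apply: cvgMl_tmp; exact: cvF.
  rewrite mulrBl mul1r; apply: (cvg_unique _ lhs) => //.
  apply: cvg_trans rhs; apply: near_eq_cvg; near=> n.
  rewrite /pseries /series /= !mulr_sumr -sumrB; apply: eq_bigr => k _.
  rewrite /pseries_diffs binomial_coefS -/c.
  by case: k => [|k]; rewrite /= ?expr0 ?exprS; ring.
have pos v : `|v| < K -> 0 < 1 - v.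
  by move=> /ltr_normlW; lra.
have dH (v : R) : `|v| < K -> is_derive v 1 (fun v => F v * (1 - v) `^ r) 0.
  move=> vK.
  have d1 : is_derive v 1 (fun v : R => 1 - v) (-1).
    by apply: is_derive_eq; rewrite add0r mul1r.
  have d2 := @is_derive1_comp R (@powR R ^~ r) (fun v => 1 - v) v _ _
    (is_derive1_powR r (pos _ vK)) d1.
  have d3 := is_deriveM (dF _ vK) d2.
  apply: is_derive_eq d3 _.
  have e : (1 - v) `^ r = (1 - v) * (1 - v) `^ (r - 1).
    by rewrite mulr_powRB1// ltW// pos.
  rewrite /= e /GRing.scale /=.
  transitivity ((1 - v) `^ (r - 1) * ((1 - v) * G v - r * F v)); first by ring.
  by rewrite ode// subrr mulr0.
have F0 : F 0 = 1.
  apply: (@lim_near_cst R^o) => //; near=> n.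
  have n0 : (0 < n)%N by near: n; exact: nbhs_infty_gt.
  rewrite /pseries /series /= -(prednK n0) big_nat_recl// big1 => [|i _].
    by rewrite addr0 expr0 mulr1 /c /binomial_coef /rising_fact big_ord0 divr1.
  by rewrite expr0n mulr0.
have := is_derive_eq_const dH uK; rewrite F0 subr0 powR1 mul1r => FE.
have -> : (1 - u) `^ (- r) = F u.
  have P0 : (1 - u) `^ r != 0 by rewrite gt_eqF// powR_gt0// pos.
  by apply: (mulIf P0); rewrite powRN mulVf.
exact: cvF.
Unshelve. all: by end_near. Qed.

End BinomialSeries.

Section ExponentialGeneratingFunction.
Variable R : realType.
Implicit Types (r t x : R).

Lemma iter_fdiff_expR k m t :
  iter k fdiff (fun m => expR (m%:R * t)) m = expR t ^+ m * (expR t - 1) ^+ k.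
Proof.
elim: k m => [|k IH] m; first by rewrite mulr1 /= expRM_natl.
by rewrite iterS /fdiff !IH !exprS; ring.
Qed.

(** Termwise differences of the exponential series of m t, taken in m. *)
Lemma cvg_iter_fdiff_series k m t :
  series (fun n => iter k fdiff (fun m => (m ^ n)%:R) m * (t ^+ n / n`!%:R))
    @ \oo --> expR t ^+ m * (expR t - 1) ^+ k.
Proof.
rewrite -iter_fdiff_expR; elim: k m => [|k IH] m /=.
  have := is_cvg_series_exp_coeff (m%:R * t).
  apply: cvg_trans; apply: near_eq_cvg; near=> N.
  by rewrite /series /=; apply: eq_bigr => n _; rewrite /exp_coeff /= exprMn natrX mulrA.
rewrite [X in _ --> X]/fdiff.
apply: cvg_trans (cvgB (IH m.+1) (IH m)); apply: near_eq_cvg; near=> N.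
rewrite !fctE /series /= -sumrB; apply: eq_bigr => n _.
by rewrite -mulrBl.
Unshelve. all: by end_near. Qed.

Lemma cvg_stirling2_series k t :
  series (fun n => (k`! * stirling2 n k)%:R * (t ^+ n / n`!%:R))
    @ \oo --> (expR t - 1) ^+ k.
Proof.
have := @cvg_iter_fdiff_series k 0 t; rewrite mul1r.
by under eq_fun do rewrite iter_fdiff_expn.
Qed.

(** For t < 0 this is e^t + e^(-t) >= 2. *)
Lemma norm_expRB1 t : `|expR t - 1| <= expR `|t| - 1.
Proof.
have [t0|t0] := leP 0 t.
  by rewrite !ger0_norm// subr_ge0 -expR0 ler_expR.
rewrite (ltr0_norm t0) ltr0_norm; last by rewrite subr_lt0 expR_lt1.
by have := expR_ge1Dx t; have := expR_ge1Dx (- t); lra.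
Qed.

Lemma horner_geom_poly_rising r n x :
  (geom_poly_rising r n).[x] =
  \sum_(k < n.+1) (stirling2 n k)%:R * rising_fact r k * x ^+ k.
Proof.
rewrite /geom_poly_rising horner_sum; apply: eq_bigr => k _.
by rewrite hornerZ hornerXn.
Qed.

(** Tannery's theorem applied to the partial sums over n < N of the k-th terms
    binomial_coef r k * (x (e^t - 1))^k, dominated by the corresponding terms at
    |x| and |t|.  As S(n,k) = 0 for k > n, the sum over k < N of these partial sums
    is the N-th partial sum of the generating function. *)
Lemma cvg_geom_poly_rising r x t : 0 < r ->
  `|x| * (expR `|t| - 1) < (8 * (r + 1))^-1 ->
  series (fun n => (geom_poly_rising r n).[x] * (t ^+ n / n`!%:R)) @ \oo
    --> (1 - x * (expR t - 1)) `^ (- r).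
Proof.
move=> r0 xtK; set K := (_ * _)^-1 in xtK.
have fact0 j : (j`!%:R : R) != 0 by rewrite pnatr_eq0 -lt0n fact_gt0.
have e0 : 0 <= expR `|t| - 1 by rewrite subr_ge0 -expR0 ler_expR.
pose a k n y s := binomial_coef r k * y ^+ k *
  ((k`! * stirling2 n k)%:R * (s ^+ n / n`!%:R)).
have cvga k y s : series (fun n => a k n y s) @ \oo
    --> binomial_coef r k * (y * (expR s - 1)) ^+ k.
  rewrite exprMn mulrA.
  apply: cvg_trans (cvgMl_tmp (@cvg_stirling2_series k s)).
  apply: near_eq_cvg; near=> N.
  by rewrite /series /= mulr_sumr.
have bc0 k : 0 <= binomial_coef r k by rewrite divr_ge0 ?rising_fact_ge0.
have a0 k n : 0 <= a k n `|x| `|t|.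
  apply: mulr_ge0; first by apply: mulr_ge0 => //; exact: exprn_ge0.
  by apply: mulr_ge0 => //; apply: divr_ge0 => //; exact: exprn_ge0.
have normxt : `|x * (expR t - 1)| <= `|x| * (expR `|t| - 1).
  by rewrite normrM ler_wpM2l ?norm_expRB1.
have := @tannery R (fun k N => series (fun n => a k n x t) N)
  (fun k => binomial_coef r k * (x * (expR t - 1)) ^+ k)
  (fun k => binomial_coef r k * (`|x| * (expR `|t| - 1)) ^+ k)
  ((1 - x * (expR t - 1)) `^ (- r)).
have tP : forall k N, `|series (fun n => a k n x t) N| <=
    binomial_coef r k * (`|x| * (expR `|t| - 1)) ^+ k.
  move=> k N; rewrite -(cvg_lim _ (@cvga k `|x| `|t|))//.
  apply: le_trans (nondecreasing_cvgn_le _ (cvgP _ (@cvga k `|x| `|t|)) N);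
    last exact: nondecreasing_series.
  rewrite /series /=; apply: (le_trans (ler_norm_sum _ _ _)).
  apply: ler_sum => n _; rewrite /a; move: (binomial_coef r k) (bc0 k) => c c0.
  by rewrite !normrM !normrX normfV !normr_nat (ger0_norm c0).
move=> /(_ tP) {tP}.
have tP : cvgn (series (fun k => binomial_coef r k * (`|x| * (expR `|t| - 1)) ^+ k)).
  apply: cvgP (cvg_binomial_series r0 _).
  by rewrite ger0_norm// mulr_ge0.
move=> /(_ tP (fun k => @cvga k x t)) {tP}.
move=> /(_ (cvg_binomial_series r0 (le_lt_trans normxt xtK))).
apply: cvg_trans; apply: near_eq_cvg; near=> N.
rewrite /series /= exchange_big /=; apply: eq_big_nat => n /andP[_ nN].
rewrite horner_geom_poly_rising mulr_suml (big_ord_widen N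
  (fun k => (stirling2 n k)%:R * rising_fact r k * x ^+ k * (t ^+ n / n`!%:R)))//.
rewrite big_mkord [RHS]big_mkcond; apply: eq_bigr => k _.
have -> : a k n x t = (stirling2 n k)%:R * rising_fact r k * x ^+ k * (t ^+ n / n`!%:R).
  by rewrite /a /binomial_coef natrM; field; rewrite !fact0.
case: ifPn => //; rewrite -leqNgt => nk.
by rewrite stirling2_gt// !mul0r.
Unshelve. all: by end_near. Qed.

Lemma near_expR_small x K : 0 < K ->
  \forall t \near (0 : R), `|x| * (expR `|t| - 1) < K.
Proof.
move=> K0.
have : `|x| * (expR `|t| - 1) @[t --> (0 : R)] --> `|x| * (expR `|0 : R| - 1).
  apply: cvgMl_tmp; apply: cvgB; last exact: cvg_cst.
  apply: continuous_cvg; first exact: continuous_expR.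
  exact: norm_continuous.
rewrite normr0 expR0 subrr mulr0 => /cvgr_lt; exact.
Qed.

Lemma near_cvg_geom_poly_rising r x : 0 < r ->
  \forall t \near (0 : R), 0 < 1 - x * (expR t - 1) /\
    series (fun n => (geom_poly_rising r n).[x] * (t ^+ n / n`!%:R)) @ \oo
      --> (1 - x * (expR t - 1)) `^ (- r).
Proof.
move=> r0; have K0 : 0 < (8 * (r + 1))^-1 by rewrite invr_gt0 mulr_gt0// addr_gt0.
near=> t.
have tK : `|x| * (expR `|t| - 1) < (8 * (r + 1))^-1.
  by near: t; exact: near_expR_small.
split; last exact: cvg_geom_poly_rising.
rewrite subr_gt0; apply: le_lt_trans (ler_norm _) _.
apply: (@le_lt_trans _ _ (`|x| * (expR `|t| - 1))).
  by rewrite normrM ler_wpM2l ?norm_expRB1.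
by apply: (lt_trans tK); rewrite invf_lt1 ?mulr_gt0 ?addr_gt0//; lra.
Unshelve. all: by end_near. Qed.

End ExponentialGeneratingFunction.

(** * The geometric polynomials *)

Lemma geom_polyrE (R : realType) (r : R) :
  0 < r -> geom_polyr r = geom_poly_rising r.
Proof.
move=> r0; apply/funext => n; rewrite /geom_polyr scaler_sumr; apply: eq_bigr => k _.
have G0 : Gamma r != 0 by rewrite gt_eqF ?Gamma_gt0.
by rewrite scalerA Gamma_rising_fact//; congr (_ *: _); field.
Qed.

Theorem proposition2 (R : realType) :
  (forall r : R, 0 < r ->
    (* formal power series in t over R[x] *)
    (forall n : nat,
       fps_powr (@fps_base R) (- r) n = fps_egf (geom_polyr r) n) /\
    (* fixed x, small t *)
    (forall x : R, \forall t \near (0 : R),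
       0 < 1 - x * (expR t - 1) /\
       series (fun n : nat => (geom_polyr r n).[x] * (t ^+ n / n`!%:R)) @ \oo
         --> (1 - x * (expR t - 1)) `^ (- r))) /\
  (* r = 1; formally, 1 / f is the inverse of f for the Cauchy product *)
  ((forall n : nat,
      fps_mul (@fps_base R) (fps_egf (@geom_poly R)) n = @fps_one R _ n) /\
   (forall x : R, \forall t \near (0 : R),
      0 < 1 - x * (expR t - 1) /\
      series (fun n : nat => (@geom_poly R n).[x] * (t ^+ n / n`!%:R)) @ \oo
        --> (1 - x * (expR t - 1))^-1)).
Proof.
split=> [r r0|]; split=> [n|x].
- by rewrite geom_polyrE// fps_powr_base.
- by rewrite geom_polyrE//; exact: near_cvg_geom_poly_rising.
- exact: fps_mul_base_geom_poly.
- apply: filterS (near_cvg_geom_poly_rising x ltr01) => t [pos].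
  by rewrite -geom_poly1 powR_inv1// ltW.
Qed.
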